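(* Consider the problem $$(\ast)\qquad \max_{\delta\in\Delta}\int_{\Theta_1}g(p(\theta;\delta))\,\Lambda_1(d\theta)\quad\text{subject to } p(\theta_0;\delta)\le\alpha .$$ Suppose that (A1) $\lim_{n\to\infty}\int_{\mathbb{Y}}|f_{\theta_n}(y)-f_\theta(y)|\,\mu(dy)=0$ whenever $\theta_n,\theta\in\Theta$, $\theta_n\to\theta$, and $\mu_\theta,\mu_{\theta'}$ are mutually absolutely continuous for all $\theta,\theta'\in\Theta$; (A2) $g$ is continuously differentiable on $(0,1)$ and continuous at $0$ and $1$; and (A3) $g'(t)>0$ for $0<t<1$. Let $T:\mathbb{Y}\to\mathbb{R}$ be a measurable function, and assume that for each $\theta\in\Theta_1$ there exists a strictly convex function $\phi_\theta:\mathbb{R}\to\mathbb{R}$ such that $f_\theta(y)/f_{\theta_0}(y)=\phi_\theta(T(y))$ for $y\in\mathbb{Y}$, understood as $f_\theta(y)=\phi_\theta(T(y))f_{\theta_0}(y)$. Then there exists an optimal rule $\delta^*$ for $(\ast)$ such that $p(\theta_0;\delta^* )=\alpha$ and, for some constants $-\infty\le\ell<u\le\infty$ and a measurable function $\gamma:\mathbb{Y}\to[0,1]$, for each $y\in\mathbb{Y}$, $$\delta^*(y)=\begin{cases}1,&T(y)>u\text{ or }T(y)<\ell\\ \gamma(y),&T(y)\in\{\ell,u\}\\ 0,&\ell<T(y)<u.\end{cases}$$ Further, if in addition $\mu(\{y\in\mathbb{Y}:T(y)=c\})=0$ for every $c\in\mathbb{R}$, then such an optimal rule can be taken of the form $\delta^*(y)=\mathbf{1}\{T(y)\ge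 u\text{ or }T(y)\le\ell\}$ for some constants $-\infty\le\ell<u\le\infty$.
   Context: Let $\Theta\subset\mathbb{R}^{d_1}$ ($d_1\ge1$) be compact, $\theta_0\in\Theta$, and $\Theta_1:=\Theta\setminus\{\theta_0\}$, assumed non-empty. Let $\mathbb{Y}\subset\mathbb{R}^{d_2}$ ($d_2\ge1$) be the observation space, $\mu$ a $\sigma$-finite measure on $\mathbb{Y}$, and for each $\theta\in\Theta$ let $f_\theta$ be a probability density function with respect to $\mu$; $(\theta,y)\mapsto f_\theta(y)$ is jointly measurable. Let $\mu_\theta$ be the probability measure with $d\mu_\theta/d\mu=f_\theta$. $\Delta$ is the set of all randomized decision rules, i.e. measurable functions $\delta:\mathbb{Y}\to[0,1]$, and $p(\theta;\delta)=\int_{\mathbb{Y}}\delta(y)f_\theta(y)\,\mu(dy)$. Here $\alpha\in(0,1)$, $g:[0,1]\to\mathbb{R}$ is a measurable function, and $\Lambda_1$ is a probability measure on $\Theta_1$.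
   Formalization: In the first conclusion, ℓ<u is replaced by: ℓ<u, or ℓ=u=c finite with μ_{θ0}(T=c) ≥ 1−α. With such an atom the strict inequality can fail, e.g. μ=0.9δ_0+0.1·Unif[−1,1], f_{θ0}=1, f_{θ1}=1/2+15y², T=y, α=1/2, g(t)=t. *)

(* Defs.v *)
From HB Require Import structures.
From mathcomp Require Import all_boot all_order all_algebra.
From mathcomp Require Import all_classical all_reals all_analysis.

Set Implicit Arguments.
Unset Strict Implicit.
Unset Printing Implicit Defensive.

Import Order.TTheory GRing.Theory Num.Theory.
Import numFieldNormedType.Exports.

Local Open Scope classical_set_scope.
Local Open Scope ring_scope.

Definition borel_rV (R : realType) (d : nat) :=
  g_sigma_algebraType (@open 'rV[R]_d).

(* A set [A] as a type; the proof of non-emptiness is only there because the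
   measurable types of the library are pointed. *)
Definition nonempty_type (T : Type) (A : set T) (A0 : A !=set0) : Type :=
  {x : T | A x}.

HB.instance Definition _ (T : Type) (A : set T) (A0 : A !=set0) :=
  gen_eqMixin (nonempty_type A0).
HB.instance Definition _ (T : Type) (A : set T) (A0 : A !=set0) :=
  gen_choiceMixin (nonempty_type A0).
HB.instance Definition _ (T : Type) (A : set T) (A0 : A !=set0) :=
  isPointed.Build (nonempty_type A0)
    (exist A (sval (cid A0)) (svalP (cid A0))).

(* The subset [A] of R^d with the trace of the Borel sigma-algebra; [A] need
   not be a Borel set. *)
Definition borel_subset (R : realType) (d : nat) (A : set 'rV[R]_d)
    (A0 : A !=set0) :=
  g_sigma_algebra_preimageType
    (fun x : nonempty_type A0 => (proj1_sig x : borel_rV R d)).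

Section decision.
Context d (Y : measurableType d) (R : realType) (Theta : Type).
Variables (mu : {measure set Y -> \bar R}) (f : Theta -> Y -> R).

Definition decision_rule : set (Y -> R) :=
  [set delta : Y -> R |
    measurable_fun setT delta /\ (forall y, 0 <= delta y <= 1)].

Definition density_measure (theta : Theta) (A : set Y) : \bar R :=
  \int[mu]_(y in A) (f theta y)%:E.

Definition power (theta : Theta) (delta : Y -> R) : R :=
  \int[mu]_y (delta y * f theta y).

End decision.

(* [inj] is the inclusion of the alternatives into the parameter space. *)
Section problem.
Context d (Y : measurableType d) (R : realType) (Theta : Type).
Context d1 (Theta1 : measurableType d1) (inj : Theta1 -> Theta).
Variables (mu : {measure set Y -> \bar R}) (f : Theta -> Y -> R).
Variables (g : R -> R) (Lambda1 : probability Theta1 R).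
Variables (theta0 : Theta) (alpha : R).

Definition objective (delta : Y -> R) : R :=
  \int[Lambda1]_theta g (power mu f (inj theta) delta).

Definition optimal_rule (delta : Y -> R) : Prop :=
  [/\ decision_rule delta,
      power mu f theta0 delta <= alpha &
      forall delta', decision_rule delta' ->
        power mu f theta0 delta' <= alpha ->
        objective delta' <= objective delta].

End problem.

Definition strictly_convex (R : realType) (phi : R -> R) : Prop :=
  forall x y t : R, x != y -> 0 < t < 1 ->
    phi (t * x + (1 - t) * y) < t * phi x + (1 - t) * phi y.

(* Main.v *)
Require Import Defs.
From mathcomp Require Import all_boot all_order all_algebra.
From mathcomp Require Import all_classical all_reals all_analysis.
From mathcomp Require Import measurable_realfun ring lra.
Import Order.TTheory GRing.Theory Num.Theory.
Import numFieldNormedType.Exports.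
Local Open Scope classical_set_scope.
Local Open Scope ring_scope.

(** The idea is that every test is dominated, in the limit, by two-sided tests,
    simultaneously at all alternatives, so that no first-order condition on
    the objective is needed.

    Write [w] for the null density and [E b] for [\int b w]. Replacing
    [phi_theta] by its positive part changes nothing where [w] is positive, so
    that [f_theta = phi_theta(T) w] with [phi_theta] convex and nonnegative.
    The two-sided tests of size [alpha] form a curve [delta_a], where
    [0 <= a <= alpha] is the mass put on the lower tail
    ([two_sided_test]). Such a test is determined by two cuts of the real line
    that reject nothing between them.

    Suppose first that [T] is bounded. Given a rule [delta] of size [alpha], the
    intermediate value theorem gives [a] such that [delta_a] and [delta] also
    have the same value of [E (_ T)] ([exists_moment_match]). The difference
    [delta_a - delta] is then orthogonal to all affine functions of [T] and has
    signs plus, minus, plus. A convex [phi] lies above its chord through the two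
    cuts outside them and below it between them; hence
    [E ((delta_a - delta) phi(T)) >= 0] ([two_sided_test_dominates]): the test
    [delta_a] is at least as powerful as [delta] at every alternative.

    A general [T] may fail to be integrable, and then the moment [E (_ T)] has
    no meaning. So [T] is replaced by its truncation to [[-n, n]], which still
    has the right position with respect to the truncated cuts. This costs an
    error that depends on [theta] and tends to 0 for each [theta], because
    [0 <= phi(trunc T) <= phi(0) + phi(T)] ([truncation_error_cvg0]).

    Finally [a |-> p(theta; delta_a)] is continuous, hence so is the objective
    along the curve, and it has a maximum at some [a]. For a rule [delta] of
    size [alpha], the objective at [delta] is the limit of
    [\int g(min(p(theta; delta_{a_n}), p(theta; delta)))], and each of these
    integrals is at most the objective at [delta_{a_n}], thus at most the
    maximum ([exists_optimal_two_sided_test]). Rules of size less than [alpha] can be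
    enlarged, as [g] is nondecreasing. *)

Set Implicit Arguments.
Unset Strict Implicit.

(** * Convex functions and their chords *)

(** Convexity, written without division. Unlike strict convexity, it passes to
    the positive part. *)
Definition below_chords (R : realType) (phi : R -> R) : Prop :=
  forall x y z : R, x <= y <= z ->
    phi y * (z - x) <= phi x * (z - y) + phi z * (y - x).

Section convex.
Context {R : realType}.
Implicit Types phi : R -> R.

Lemma below_chords_strictly_convex phi :
  strictly_convex phi -> below_chords phi.
Proof.
move=> phic x y z /andP[xy yz].
move: xy; rewrite le_eqVlt => /orP[/eqP<-|xy]; first by lra.
move: yz; rewrite le_eqVlt => /orP[/eqP->|yz]; first by lra.
have zx : 0 < z - x by lra.
have zx0 : z - x != 0 by rewrite gt_eqF.
have t01 : 0 < (z - y) / (z - x) < 1.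
  apply/andP; split.
    by rewrite divr_gt0 // ?subr_gt0.
  rewrite ltr_pdivrMr// mul1r.
  by rewrite ltrD2l ltrN2.
have xz : x != z by rewrite lt_eqF// (lt_trans xy).
have := phic x z _ xz t01.
have -> : (z - y) / (z - x) * x + (1 - (z - y) / (z - x)) * z = y.
  by field.
have -> : (z - y) / (z - x) * phi x + (1 - (z - y) / (z - x)) * phi z =
  (phi x * (z - y) + phi z * (y - x)) / (z - x) by field.
by rewrite ltr_pdivlMr// => /ltW.
Qed.

Lemma below_chords_pos_part phi :
  below_chords phi -> below_chords (fun t => Num.max 0 (phi t)).
Proof.
move=> phic x y z /[dup] xyz /andP[xy yz]; rewrite maxr_pMl; last by lra.
rewrite ge_max mul0r; apply/andP; split.
  by rewrite addr_ge0// mulr_ge0 ?subr_ge0// le_max lexx.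
by apply: (le_trans (phic _ _ _ xyz)); rewrite lerD// ler_wpM2r ?subr_ge0//
  le_max lexx orbT.
Qed.

Lemma below_chords_le_max phi x y z : below_chords phi ->
  x <= y <= z -> phi y <= Num.max (phi x) (phi z).
Proof.
move=> phic /[dup] xyz /andP[xy yz].
have [xz|xz] := eqVneq x z.
  have -> : y = x by apply/eqP; rewrite eq_le xy xz yz.
  by rewrite le_max lexx.
have zx : 0 < z - x by rewrite subr_gt0 lt_neqAle xz (le_trans xy).
rewrite -(ler_pM2r zx) (le_trans (phic _ _ _ xyz))//.
have -> : Num.max (phi x) (phi z) * (z - x) =
  Num.max (phi x) (phi z) * (z - y) + Num.max (phi x) (phi z) * (y - x) by ring.
by rewrite lerD// ler_wpM2r ?subr_ge0// le_max lexx ?orbT.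
Qed.

(** By [below_chords_le_max] the sublevel sets are intervals. *)
Lemma below_chords_measurable phi :
  below_chords phi -> measurable_fun setT phi.
Proof.
move=> phic.
move=> mD.
apply: (measurability _ (measurable_realfun.RGenOInfty.measurableE R)) => //.
move=> _ [_ [r ->] <-]; rewrite setTI -[X in measurable X]setCK.
apply: measurableC; apply: is_interval_measurable => a b /=.
rewrite !in_itv/= !andbT => /negP; rewrite -leNgt => ar /negP.
rewrite -leNgt => br c acb; apply/negP.
rewrite in_itv/= andbT -leNgt (le_trans (below_chords_le_max phic acb))//.
by rewrite ge_max ar.
Qed.

(** The line is the chord through [l] and [u] or, when [l = u], a supporting
    line at that point. At both ends the two conclusions together say that it
    meets the graph. *)
Lemma below_chords_line phi l u : below_chords phi -> l <= u ->
  exists A B : R, forall x,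
    (x <= l \/ u <= x -> 0 <= phi x - (A * x + B)) /\
    (l <= x <= u -> phi x - (A * x + B) <= 0).
Proof.
move=> phic; rewrite le_eqVlt => /orP[/eqP <-{u}|lu].
  (* The slope of the supporting line is the supremum of the slopes on the
     left. *)
  pose S := [set (phi l - phi x) / (l - x) | x in [set x | x < l]].
  have ubS z : l < z -> ubound S ((phi z - phi l) / (z - l)).
    move=> lz _ [x /= xl <-].
    rewrite ler_pdivrMr ?subr_gt0// mulrAC ler_pdivlMr ?subr_gt0//.
    have xlz : x <= l <= z by rewrite !ltW.
    by have := phic x l z xlz; nra.
  have supS : has_sup S.
    split; first by exists ((phi l - phi (l - 1)) / (l - (l - 1)));
      exists (l - 1) => //=; lra.
    by exists ((phi (l + 1) - phi l) / (l + 1 - l)); apply: ubS; lra.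
  exists (sup S), (phi l - sup S * l) => x; split; last first.
    by move=> xl; have -> : x = l; [lra|rewrite subrKC subrr].
  move=> _; have [xl|lx|->] := ltgtP x l; last by rewrite subrKC subrr.
  - have : (phi l - phi x) / (l - x) <= sup S.
      by apply: sup_upper_bound => //; exists x.
    by rewrite ler_pdivrMr ?subr_gt0//; lra.
  - have : sup S <= (phi x - phi l) / (x - l).
      by apply: ge_sup; [exact: supS.1|exact: ubS].
    by rewrite ler_pdivlMr ?subr_gt0//; lra.
pose A := (phi u - phi l) / (u - l).
have ul0 : u - l != 0 by rewrite subr_eq0 gt_eqF.
have ul : 0 < u - l by rewrite subr_gt0.
exists A, (phi l - A * l) => x.
have E : (phi x - (A * x + (phi l - A * l))) * (u - l) =
  phi x * (u - l) - (phi l * (u - x) + phi u * (x - l)).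
  by rewrite /A; field.
split => [x_out|x_in].
  rewrite -(pmulr_lge0 _ ul) E.
  case: x_out => h.
    have h1 : x <= l <= u by rewrite h ltW.
    by have := phic x l u h1; lra.
  have h1 : l <= u <= x by rewrite h ltW.
  by have := phic l u x h1; lra.
by rewrite -(pmulr_lle0 _ ul) E; have := phic l x u x_in; lra.
Qed.

End convex.

(** * Integrals against a density *)

Lemma Rintegral_dominated_cvg d (Y : measurableType d) (R : realType)
    (mu : {measure set Y -> \bar R}) (f_ : nat -> Y -> R) (f h : Y -> R) :
  (forall n, measurable_fun setT (f_ n)) -> measurable_fun setT f ->
  (forall y, f_ n y @[n --> \oo] --> f y) ->
  mu.-integrable setT (EFin \o h) -> (forall n y, `|f_ n y| <= h y) ->
  \int[mu]_y f_ n y @[n --> \oo] --> \int[mu]_y f y.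
Proof.
move=> mf_ mf f_f ih f_h.
have [|||||intf _] := @dominated_convergence _ _ _ mu _ measurableT
    (fun n => EFin \o f_ n) (EFin \o f) (EFin \o h).
- by move=> n; exact/measurable_EFinP.
- exact/measurable_EFinP.
- by apply: aeW => y _; apply: cvg_EFin; [exact: nearW|exact: f_f].
- exact: ih.
- by apply: aeW => y n _; rewrite /= lee_fin.
move=> cv; apply: fine_cvg; rewrite fineK//.
exact: (integrable_fin_num measurableT intf).
Qed.

Definition wmean d (Y : measurableType d) (R : realType)
  (mu : {measure set Y -> \bar R}) (w b : Y -> R) : R :=
  \int[mu]_y (b y * w y).

Definition bounded_measurable d (Y : measurableType d) (R : realType)
  (b : Y -> R) : Prop :=
  measurable_fun setT b /\ exists C, forall y, `|b y| <= C.

Section bounded_measurable.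
Context d (Y : measurableType d) (R : realType).
Implicit Types b : Y -> R.

Lemma bounded_measurable_cst c : bounded_measurable (fun _ : Y => c : R).
Proof. by split => //; exists `|c|. Qed.

Lemma bounded_measurableD b1 b2 : bounded_measurable b1 ->
  bounded_measurable b2 -> bounded_measurable (fun y => b1 y + b2 y).
Proof.
move=> [m1 [C1 h1]] [m2 [C2 h2]]; split; first exact: measurable_funD.
by exists (C1 + C2) => y; rewrite (le_trans (ler_normD _ _))// lerD.
Qed.

Lemma bounded_measurableM b1 b2 : bounded_measurable b1 ->
  bounded_measurable b2 -> bounded_measurable (fun y => b1 y * b2 y).
Proof.
move=> [m1 [C1 h1]] [m2 [C2 h2]]; split; first exact: measurable_funM.
by exists (C1 * C2) => y; rewrite normrM ler_pM.
Qed.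

Lemma bounded_measurableB b1 b2 : bounded_measurable b1 ->
  bounded_measurable b2 -> bounded_measurable (fun y => b1 y - b2 y).
Proof.
move=> [m1 [C1 h1]] [m2 [C2 h2]]; split; first exact: measurable_funB.
by exists (C1 + C2) => y; rewrite (le_trans (ler_normB _ _))// lerD.
Qed.

Lemma bounded_measurable_norm b : bounded_measurable b ->
  bounded_measurable (fun y => `|b y|).
Proof.
move=> [m [C h]]; split; first exact: measurableT_comp.
by exists C => y; rewrite normr_id.
Qed.

Lemma bounded_measurable_rule b : decision_rule b -> bounded_measurable b.
Proof.
move=> [m h]; split => //; exists 1 => y.
by have /andP[h0 h1] := h y; rewrite ger0_norm.
Qed.

End bounded_measurable.

Section wmean.
Context d (Y : measurableType d) (R : realType).
Variables (mu : {measure set Y -> \bar R}) (w : Y -> R).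
Hypothesis iw : mu.-integrable setT (EFin \o w).
Local Notation E := (wmean mu w).
Implicit Types b : Y -> R.

Lemma integrable_wmean b : bounded_measurable b ->
  mu.-integrable setT (EFin \o (fun y => b y * w y)).
Proof.
move=> [mb [C bC]].
have bb : [bounded b x | x in setT].
  exists C; split; first exact: num_real.
  by move=> x Cx y _ /=; rewrite (le_trans (bC y))// ltW.
exact: (integrableMr measurableT mb bb iw).
Qed.

Lemma wmeanD b1 b2 : bounded_measurable b1 -> bounded_measurable b2 ->
  E (fun y => b1 y + b2 y) = E b1 + E b2.
Proof.
move=> h1 h2; rewrite -RintegralD//; [|exact: integrable_wmean..].
by apply: eq_Rintegral => y _; rewrite mulrDl.
Qed.

Lemma wmeanB b1 b2 : bounded_measurable b1 -> bounded_measurable b2 ->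
  E (fun y => b1 y - b2 y) = E b1 - E b2.
Proof.
move=> h1 h2; rewrite -RintegralB//; [|exact: integrable_wmean..].
by apply: eq_Rintegral => y _; rewrite mulrBl.
Qed.

Lemma wmeanZ c b : bounded_measurable b -> E (fun y => c * b y) = c * E b.
Proof.
move=> h; rewrite -RintegralZl//; [|exact: integrable_wmean..].
by apply: eq_Rintegral => y _; rewrite mulrA.
Qed.

Lemma eq_wmean b1 b2 : b1 =1 b2 -> E b1 = E b2.
Proof. by move=> h; apply: eq_Rintegral => y _; rewrite h. Qed.

Lemma wmean_dominated_cvg (b_ : nat -> Y -> R) b C :
  (forall n, measurable_fun setT (b_ n)) -> measurable_fun setT b ->
  (forall n y, `|b_ n y| <= C) ->
  (forall y, b_ n y @[n --> \oo] --> b y) ->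
  E (b_ n) @[n --> \oo] --> E b.
Proof.
move=> mb_ mb bC bb.
have mw : measurable_fun setT w.
  by apply/measurable_EFinP; exact: (measurable_int mu iw).
apply: (@Rintegral_dominated_cvg _ _ _ _ _ _ (fun y => C * `|w y|)).
- by move=> n; exact: measurable_funM.
- exact: measurable_funM.
- by move=> y; apply: cvgMl; exact: bb.
- exact: (integrableZl _ _ (integrable_norm iw)).
- by move=> n y; rewrite normrM ler_wpM2r.
Qed.

Hypothesis w_ge0 : forall y, 0 <= w y.

Lemma le_wmean b1 b2 : bounded_measurable b1 -> bounded_measurable b2 ->
  (forall y, b1 y <= b2 y) -> E b1 <= E b2.
Proof.
move=> h1 h2 h; apply: le_Rintegral => //; [exact: integrable_wmean..|].
by move=> y _; rewrite ler_wpM2r.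
Qed.

Hypothesis w1 : \int[mu]_y w y = 1.

Lemma wmean_cst c : E (fun _ => c) = c.
Proof. by rewrite /wmean RintegralZl// w1 mulr1. Qed.

Lemma wmean_rule b : decision_rule b -> 0 <= E b <= 1.
Proof.
move=> hb; have hb' := bounded_measurable_rule hb.
rewrite -[X in X <= E b](wmean_cst 0) -[X in E b <= X](wmean_cst 1).
by rewrite !le_wmean//; first [exact: bounded_measurable_cst|
  move=> y; case/andP: (hb.2 y)].
Qed.

End wmean.

(** * Lower cuts of a statistic *)

Definition lower_cut (R : realType) (c : \bar R) (k t : R) : R :=
  if (t%:E < c)%E then 1 else if t%:E == c then k else 0.

Section lower_cut.
Context {R : realType}.
Implicit Types (c : \bar R) (k t : R).

Lemma lower_cut_itv01 c k t : 0 <= k <= 1 -> 0 <= lower_cut c k t <= 1.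
Proof.
by rewrite /lower_cut => k01; case: ifP => _; [lra|case: ifP => _ //; lra].
Qed.

Lemma lower_cut_measurable c k : measurable_fun setT (lower_cut c k).
Proof.
apply: measurable_fun_ifT => //.
  apply: (@measurable_fun_lte _ R R setT EFin (cst c)) => //.
apply: measurable_fun_ifT => //.
apply: (measurable_fun_bool true).
rewrite setTI; case: c => [c| |].
- rewrite (_ : _ @^-1` _ = [set c]) //.
  by apply/seteqP; split => x /=; [rewrite eqe => /eqP|move=> ->; rewrite eqxx].
- rewrite (_ : _ @^-1` _ = set0) //.
  by apply/seteqP; split => x /=.
- rewrite (_ : _ @^-1` _ = set0) //.
  by apply/seteqP; split => x /=.
Qed.

Lemma lower_cut_homo c c' k k' t : 0 <= k <= 1 -> 0 <= k' <= 1 ->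
  (c < c')%E \/ (c = c' /\ k <= k') -> lower_cut c k t <= lower_cut c' k' t.
Proof.
move=> k01 k'01 [cc'|[-> kk']]; rewrite /lower_cut.
  have [tc|tc|->] := ltgtP t%:E c.
  - by rewrite (lt_trans tc cc') lexx.
  - by case: ifP => _ //; case: ifP => _ //; case/andP: k'01.
  - by rewrite cc'; case/andP: k01.
by case: ifP => // _; case: ifP.
Qed.

(** The cuts are ordered lexicographically by position and rejection
    probability. So the masses of two of them decide which one is smaller. *)
Lemma lower_cut_total c c' k k' : 0 <= k <= 1 -> 0 <= k' <= 1 ->
  (forall t, lower_cut c k t <= lower_cut c' k' t) \/
  (forall t, lower_cut c' k' t <= lower_cut c k t).
Proof.
move=> k01 k'01; have [cc'|cc'|cc'] := ltgtP c c'.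
- by left => t; apply: lower_cut_homo => //; left.
- by right => t; apply: lower_cut_homo => //; left.
- have [kk'|kk'] := leP k k'.
    by left => t; apply: lower_cut_homo => //; right.
  by right => t; apply: lower_cut_homo => //; right; split => //; exact: ltW.
Qed.

Lemma lower_cut_conv c k t :
  lower_cut c k t = (1 - k) * lower_cut c 0 t + k * lower_cut c 1 t.
Proof. by rewrite /lower_cut; case: ifP => _; [ring|case: ifP => _; ring]. Qed.

Lemma lower_cut_norm c k t : 0 <= k <= 1 -> `|lower_cut c k t| <= 1.
Proof.
by move=> /(lower_cut_itv01 c t) /andP[h0 h1]; rewrite ger0_norm.
Qed.

End lower_cut.

Section exists_lower_cut.
Context d (Y : measurableType d) (R : realType).
Variables (mu : {measure set Y -> \bar R}) (w : Y -> R) (T : Y -> R).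
Hypothesis iw : mu.-integrable setT (EFin \o w).
Hypothesis w_ge0 : forall y, 0 <= w y.
Hypothesis w1 : \int[mu]_y w y = 1.
Hypothesis mT : measurable_fun setT T.
Local Notation E := (wmean mu w).
Local Notation mass c k := (E (fun y => lower_cut c k (T y))).

Lemma lower_cut_comp_measurable c k :
  measurable_fun setT (fun y => lower_cut c k (T y)).
Proof. exact: (measurableT_comp (lower_cut_measurable c k)). Qed.

Lemma lower_cut_rule c k : 0 <= k <= 1 ->
  decision_rule (fun y => lower_cut c k (T y)).
Proof.
move=> k01; split; last by move=> y; exact: lower_cut_itv01.
exact: lower_cut_comp_measurable.
Qed.

Lemma lower_cut_bounded c k : 0 <= k <= 1 ->
  bounded_measurable (fun y => lower_cut c k (T y)).
Proof. by move=> k01; exact/bounded_measurable_rule/lower_cut_rule. Qed.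

Let cvg_mass (c_ : nat -> R) (b : Y -> R) :
  measurable_fun setT b ->
  (forall y, \forall n \near \oo, lower_cut (c_ n)%:E 0 (T y) = b y) ->
  mass (c_ n)%:E 0 @[n --> \oo] --> E b.
Proof.
move=> mb cb; apply: (wmean_dominated_cvg iw (C := 1)) => //.
- by move=> n; exact: lower_cut_comp_measurable.
- by move=> n y; apply: lower_cut_norm; rewrite lexx ler01.
- by move=> y; apply: cvg_near_cst; exact: cb.
Qed.

(** The cut [q] is a quantile: the mass strictly below [q] is at most [s] and
    the mass up to [q] at least [s], by continuity of the distribution function
    from the left and from the right. Randomizing at [q] fills the gap. *)
Lemma exists_lower_cut s : 0 < s < 1 ->
  exists c k, 0 <= k <= 1 /\ mass c k = s.
Proof.
move=> /andP[s0 s1].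
have k0 : 0 <= (0 : R) <= 1 by rewrite lexx ler01.
have k1 : 0 <= (1 : R) <= 1 by rewrite lexx ler01.
pose G t := mass t%:E 0.
have Ghomo t t' : t < t' -> G t <= G t'.
  move=> tt'; apply: le_wmean => //; [exact: lower_cut_bounded..|].
  by move=> y; apply: lower_cut_homo => //; left; rewrite lte_fin.
have cvg0 : G (- n%:R) @[n --> \oo] --> 0.
  rewrite [X in _ --> X](_ : (0 : R) = E (fun _ => 0)); last first.
    by rewrite (wmean_cst iw w1).
  apply: (cvg_mass (c_ := fun n => - n%:R)); first exact: measurable_cst.
  move=> y; near=> n; rewrite /lower_cut lte_fin ifF.
    rewrite eqe ifF //; apply/negbTE; rewrite gt_eqF// ltrNl.
    by near: n; exact: nbhs_infty_gtr.
  apply/negbTE; rewrite -leNgt lerNl ltW//.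
  by near: n; exact: nbhs_infty_gtr.
have cvg1 : G n%:R @[n --> \oo] --> (1 : R).
  rewrite [X in _ --> X](_ : (1 : R) = E (fun _ => 1)); last first.
    by rewrite (wmean_cst iw w1).
  apply: (cvg_mass (c_ := fun n => n%:R)); first exact: measurable_cst.
  move=> y; near=> n; rewrite /lower_cut lte_fin ifT//.
  by near: n; exact: nbhs_infty_gtr.
pose S := [set t | G t <= s].
have S0 : S !=set0.
  near \oo => n; exists (- n%:R); rewrite /S/= ltW//.
  by near: n; exact: (cvgr_lt _ cvg0).
have supS : has_sup S.
  split => //.
  near \oo => n; exists n%:R => t /= tS; rewrite leNgt; apply/negP => nt.
  have := le_trans (Ghomo _ _ nt) tS; rewrite leNgt => /negP; apply.
  by near: n; exact: (cvgr_gt _ cvg1).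
pose q := sup S.
have Gq : G q <= s.
  have cvgq : G (q - n.+1%:R^-1) @[n --> \oo] --> G q.
    apply: (cvg_mass (c_ := fun n => q - n.+1%:R^-1)).
      exact: lower_cut_comp_measurable.
    move=> y; have [Tq|qT] := ltP (T y) q.
      near=> n; rewrite /lower_cut !lte_fin Tq ifT//.
      rewrite ltrBrDr -ltrBrDl.
      by near: n; apply: near_infty_natSinv_lt (PosNum _); rewrite subr_gt0.
    near=> n.
    have qT' : q - n.+1%:R^-1 < T y.
      by rewrite (lt_le_trans _ qT)// ltrBlDr ltrDl invr_gt0.
    rewrite /lower_cut !lte_fin !eqe [T y < q - _]ltNge (ltW qT')/=.
    by rewrite [T y < q]ltNge qT/= !if_same.
  apply: (cvgr_to_le cvgq); near=> n.
  have [t tS qt] : exists2 t, S t & q - n.+1%:R^-1 < t.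
    by apply: sup_adherent => //; rewrite invr_gt0.
  exact: le_trans (Ghomo _ _ qt) tS.
have Hq : s <= mass q%:E 1.
  have cvgq : G (q + n.+1%:R^-1) @[n --> \oo] --> mass q%:E 1.
    apply: (cvg_mass (c_ := fun n => q + n.+1%:R^-1)).
      exact: lower_cut_comp_measurable.
    move=> y; have [Tq|qT] := leP (T y) q.
      near=> n; rewrite /lower_cut !lte_fin ifT.
        rewrite eqe; move: Tq; rewrite le_eqVlt.
        by move=> /orP[->|->]; rewrite ?if_same.
      by rewrite (le_lt_trans Tq)// ltrDl invr_gt0.
    near=> n.
    have qT' : q + n.+1%:R^-1 < T y.
      rewrite -ltrBrDl.
      by near: n; apply: near_infty_natSinv_lt (PosNum _); rewrite subr_gt0.
    rewrite /lower_cut !lte_fin !eqe.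
    by rewrite ltNge (ltW qT')/= gt_eqF// ltNge (ltW qT)/= gt_eqF.
  apply: (cvgr_to_ge cvgq); near=> n.
  rewrite leNgt; apply/negP => Gs.
  have : q + n.+1%:R^-1 <= q by apply: sup_upper_bound => //; exact: ltW.
  by rewrite gerDl leNgt invr_gt0 ltr0n.
have conv k : mass q%:E k = (1 - k) * G q + k * mass q%:E 1.
  have bZ r a : 0 <= a <= 1 ->
      bounded_measurable (fun y => r * lower_cut q%:E a (T y)).
    move=> a01; apply: bounded_measurableM; last exact: lower_cut_bounded.
    exact: bounded_measurable_cst.
  rewrite -!(wmeanZ iw); [|exact: lower_cut_bounded..].
  rewrite -(wmeanD iw); [|exact: bZ..].
  by apply: eq_wmean => y; exact: lower_cut_conv.
have [GH|GH] := eqVneq (mass q%:E 1) (G q).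
  by exists q%:E, 0; split => //; rewrite conv; lra.
have GH0 : 0 < mass q%:E 1 - G q.
  by rewrite subr_gt0 lt_neqAle eq_sym GH (le_trans Gq).
exists q%:E, ((s - G q) / (mass q%:E 1 - G q)); split.
  by rewrite divr_ge0 ?subr_ge0 ?(ltW GH0)//=;
    [rewrite ler_pdivrMr// mul1r lerD2r|rewrite (le_trans Gq)].
by rewrite conv; field; rewrite gt_eqF.
Unshelve. all: by end_near. Qed.

(** The infinite cuts at 0 and 1 make the extreme two-sided tests exactly
    one-sided. *)
Lemma exists_lower_cut_family : exists (c : R -> \bar R) (k : R -> R),
  [/\ forall s, 0 <= k s <= 1, forall s, 0 <= s <= 1 -> mass (c s) (k s) = s,
      c 0 = -oo%E & c 1 = +oo%E].
Proof.
have /choice[ck ckP] : forall s : R, exists ck : \bar R * R,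
   [/\ 0 <= ck.2 <= 1, 0 <= s <= 1 -> mass ck.1 ck.2 = s,
       s = 0 -> ck.1 = -oo%E & s = 1 -> ck.1 = +oo%E].
  move=> s.
  have k0 : 0 <= (0 : R) <= 1 by rewrite lexx ler01.
  have [->|s0] := eqVneq s 0.
    exists (-oo%E, 0); split => //= [_|/eqP]; last by rewrite eq_sym oner_eq0.
    by rewrite -[RHS](wmean_cst iw w1); apply: eq_wmean => y.
  have [->|s1] := eqVneq s 1.
    exists (+oo%E, 0); split => //= [_|/eqP]; last by rewrite oner_eq0.
    by rewrite -[RHS](wmean_cst iw w1); apply: eq_wmean => y;
      rewrite /lower_cut ltry.
  have [s01|s01] := boolP (0 < s < 1).
    have [c [k [k01 ck]]] := exists_lower_cut s01.
    by exists (c, k); split => // /eqP; rewrite ?(negbTE s0) ?(negbTE s1).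
  exists (0%E, 0); split => //= [/andP[s0' s1']|/eqP|/eqP];
    rewrite ?(negbTE s0) ?(negbTE s1)//.
  by move: s01; rewrite !lt_neqAle s0' s1' s1 eq_sym s0.
exists (fst \o ck), (snd \o ck); split => /= [s|s s01| |].
- by have [] := ckP s.
- by have [_ + _ _] := ckP s; exact.
- by have [_ _ + _] := ckP 0; exact.
- by have [_ _ _ +] := ckP 1; exact.
Qed.

End exists_lower_cut.

(** * Two-sided tests *)

Section clamp.
Context {R : realType}.
Implicit Types (l u s t m : R) (c : \bar R).

Definition clamp l u t : R := Num.max l (Num.min u t).

Lemma clamp_itv l u t : l <= u -> l <= clamp l u t <= u.
Proof. by move=> lu; rewrite /clamp le_max lexx ge_max lu ge_min lexx. Qed.

Lemma clamp_id l u t : l <= t <= u -> clamp l u t = t.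
Proof. by move=> /andP[lt tu]; rewrite /clamp (min_idPr tu) (max_idPr lt). Qed.

Lemma clamp_homo l u s t : s <= t -> clamp l u s <= clamp l u t.
Proof.
move=> st; rewrite /clamp ge_max le_max lexx/= le_max; apply/orP; right.
by rewrite le_min ge_min lexx/= ge_min st orbT.
Qed.

Lemma clamp_dist l u s t : l <= u -> `|clamp l u s - clamp l u t| <= `|s - t|.
Proof.
move=> lu; wlog st : s t / s <= t => [H|].
  by have [|/ltW] := leP s t; [exact: H|rewrite distrC (distrC s); exact: H].
rewrite distrC (distrC s) !ger0_norm ?subr_ge0 ?clamp_homo//.
rewrite /clamp; case: (leP u s) => us; case: (leP u t) => ut;
  case: (leP l u) => h1; case: (leP l s) => h2; case: (leP l t) => h3; lra.
Qed.

Lemma clamp_continuous l u : continuous (clamp l u : R -> R).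
Proof.
move=> x; apply: continuous_max; first exact: cvg_cst.
by apply: continuous_min; [exact: cvg_cst|exact: cvg_id].
Qed.

(** Extended reals are allowed so that the values of [T] and the cuts, which
    may be infinite, are truncated by the same monotone map. *)
Definition trunc m c : R :=
  match c with EFin t => clamp (- m) m t | +oo%E => m | -oo%E => - m end.

Lemma trunc_itv m c : 0 <= m -> - m <= trunc m c <= m.
Proof.
move=> m0; have mm : - m <= m by lra.
by case: c => [t| |] /=; [exact: clamp_itv|rewrite mm lexx|rewrite lexx mm].
Qed.

Lemma trunc_homo m c c' : 0 <= m -> (c <= c')%E -> trunc m c <= trunc m c'.
Proof.
move=> m0; have mm : - m <= m by lra.
case: c c' => [s| |] [t| |] //=.
- by rewrite lee_fin; exact: clamp_homo.
- by move=> _; have /andP[] := clamp_itv s mm.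
- by move=> _; have /andP[] := clamp_itv t mm.
Qed.

End clamp.

Section two_sided.
Context d (Y : measurableType d) (R : realType).
Variables (mu : {measure set Y -> \bar R}) (w : Y -> R) (T : Y -> R).
Hypothesis iw : mu.-integrable setT (EFin \o w).
Hypothesis w_ge0 : forall y, 0 <= w y.
Hypothesis w1 : \int[mu]_y w y = 1.
Hypothesis mT : measurable_fun setT T.
Local Notation E := (wmean mu w).
Variables (c : R -> \bar R) (k : R -> R) (alpha : R).
Hypothesis k01 : forall s, 0 <= k s <= 1.
Hypothesis mass_c : forall s, 0 <= s <= 1 ->
  E (fun y => lower_cut (c s) (k s) (T y)) = s.
Hypothesis c0 : c 0 = -oo%E.
Hypothesis c1 : c 1 = +oo%E.
Hypothesis alpha01 : 0 < alpha < 1.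
Implicit Types (a b s : R) (y : Y).

Let left_level a : 0 <= a <= alpha -> clamp 0 1 a = a.
Proof.
have /andP[al0 al1] := alpha01; move=> /andP[a0 aa].
by rewrite clamp_id//; apply/andP; split; lra.
Qed.

Let right_level a : 0 <= a <= alpha ->
  clamp 0 1 (a + 1 - alpha) = a + 1 - alpha.
Proof.
have /andP[al0 al1] := alpha01; move=> /andP[a0 aa].
by rewrite clamp_id//; apply/andP; split; lra.
Qed.

(** The clamp extends the family from [[0, 1]] to the line, so that it is
    Lipschitz everywhere ([lower_test_dist]). *)
Definition lower_test s y : R :=
  lower_cut (c (clamp 0 1 s)) (k (clamp 0 1 s)) (T y).

(** The lower tail has mass [a] and the upper tail, the complement of a lower
    test, has mass [alpha - a]. *)
Definition two_sided_test a y : R :=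
  lower_test a y + (1 - lower_test (a + 1 - alpha) y).

Definition left_cut a : \bar R := c (clamp 0 1 a).
Definition right_cut a : \bar R := c (clamp 0 1 (a + 1 - alpha)).

Lemma lower_test_rule s : decision_rule (lower_test s).
Proof. exact: lower_cut_rule. Qed.

Lemma lower_test_mass s : E (lower_test s) = clamp 0 1 s.
Proof. by apply: mass_c; apply: clamp_itv. Qed.

(** Lower tests are pointwise comparable, and the masses tell in which
    order. *)
Lemma lower_test_homo s s' y : s <= s' -> lower_test s y <= lower_test s' y.
Proof.
move=> /(clamp_homo 0 1); rewrite le_eqVlt /lower_test => /orP[/eqP->//|ss'].
have [] := lower_cut_total (c (clamp 0 1 s)) (c (clamp 0 1 s'))
  (k01 (clamp 0 1 s)) (k01 (clamp 0 1 s')); first exact.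
move=> h; have := le_wmean iw w_ge0
  (bounded_measurable_rule (lower_test_rule s'))
  (bounded_measurable_rule (lower_test_rule s)) (fun y => h (T y)).
by rewrite !lower_test_mass leNgt ss'.
Qed.

Lemma lower_test_bounded s : bounded_measurable (lower_test s).
Proof. exact/bounded_measurable_rule/lower_test_rule. Qed.

(** The difference of two lower tests has a constant sign, so its [L^1] norm is
    the difference of the masses. *)
Lemma lower_test_dist s s' :
  E (fun y => `|lower_test s y - lower_test s' y|) <= `|s - s'|.
Proof.
wlog ss' : s s' / s <= s' => [H|].
  have [|/ltW] := leP s s'; first exact: H.
  rewrite (distrC s) => /H; apply: le_trans.
  rewrite (@eq_wmean _ _ _ _ _ _
    (fun y => `|lower_test s' y - lower_test s y|))// => y.
  by rewrite distrC.
rewrite (@eq_wmean _ _ _ _ _ _ (fun y => lower_test s' y - lower_test s y)).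
  rewrite wmeanB//; [|exact: lower_test_bounded..].
  rewrite !lower_test_mass (le_trans (ler_norm _))// (distrC s).
  by rewrite clamp_dist.
by move=> y; rewrite distrC ger0_norm// subr_ge0 lower_test_homo.
Qed.

Lemma two_sided_test_rule a : decision_rule (two_sided_test a).
Proof.
split.
  apply: measurable_funD; first exact: (lower_test_rule a).1.
  by apply: measurable_funB => //; exact: (lower_test_rule _).1.
move=> y; have /andP[h0 h1] := (lower_test_rule a).2 y.
have /andP[h2 h3] := (lower_test_rule (a + 1 - alpha)).2 y.
have : lower_test a y <= lower_test (a + 1 - alpha) y.
  by apply: lower_test_homo; have /andP[al0 al1] := alpha01; lra.
by rewrite /two_sided_test => h; apply/andP; split; lra.
Qed.

Lemma two_sided_test_bounded a : bounded_measurable (two_sided_test a).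
Proof. exact/bounded_measurable_rule/two_sided_test_rule. Qed.

Lemma two_sided_test_mass a : 0 <= a <= alpha -> E (two_sided_test a) = alpha.
Proof.
move=> aa; rewrite wmeanD//; [|exact: lower_test_bounded|]; last first.
  by apply: bounded_measurableB;
    [exact: bounded_measurable_cst|exact: lower_test_bounded].
rewrite wmeanB//; [|exact: bounded_measurable_cst|exact: lower_test_bounded].
by rewrite (wmean_cst iw w1) !lower_test_mass right_level// left_level//; ring.
Qed.

Lemma two_sided_test_dist a b (h : Y -> R) (C : R) : measurable_fun setT h ->
  (forall y, `|h y| <= C) ->
  `|E (fun y => two_sided_test a y * h y) -
    E (fun y => two_sided_test b y * h y)| <= 2 * C * `|a - b|.
Proof.
move=> mh hC.
have bh : bounded_measurable h by split => //; exists C.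
have C0 : 0 <= C by rewrite (le_trans _ (hC point)).
have bth a' : bounded_measurable (fun y => two_sided_test a' y * h y).
  by apply: bounded_measurableM => //; exact: two_sided_test_bounded.
have bn s s' :
    bounded_measurable (fun y => `|lower_test s y - lower_test s' y|).
  apply: bounded_measurable_norm; apply: bounded_measurableB;
  exact: lower_test_bounded.
rewrite -(wmeanB iw)//.
pose D y := C * (`|lower_test a y - lower_test b y| +
  `|lower_test (a + 1 - alpha) y - lower_test (b + 1 - alpha) y|).
have bD : bounded_measurable D.
  apply: bounded_measurableM; first exact: bounded_measurable_cst.
  exact: bounded_measurableD.
have DE : E D <= 2 * C * `|a - b|.
  rewrite /D wmeanZ//; last exact: bounded_measurableD.
  rewrite wmeanD// (mulrC 2) -mulrA ler_wpM2l//.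
  rewrite mulr_natl mulr2n lerD//; first exact: lower_test_dist.
  rewrite (le_trans (lower_test_dist _ _))// le_eqVlt; apply/orP; left.
  by apply/eqP; congr `|_|; ring.
apply: le_trans DE; rewrite ler_norml.
have HD y : `|two_sided_test a y * h y - two_sided_test b y * h y| <= D y.
  rewrite -mulrBl normrM mulrC /D ler_pM//.
  rewrite /two_sided_test.
  set p := lower_test a y; set q := lower_test b y.
  set p' := lower_test _ y; set q' := lower_test _ y.
  have -> : p + (1 - p') - (q + (1 - q')) = (p - q) - (p' - q') by ring.
  exact: ler_normB.
have bDD : bounded_measurable
    (fun y => two_sided_test a y * h y - two_sided_test b y * h y).
  exact: bounded_measurableB.
apply/andP; split; last first.
  by apply: le_wmean => // y; rewrite (le_trans (ler_norm _)).
have -> : - E D = E (fun y => -1 * D y) by rewrite (wmeanZ iw _ bD) mulN1r.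
apply: le_wmean => //.
  by apply: bounded_measurableM => //; exact: bounded_measurable_cst.
by move=> y; have := HD y; rewrite mulN1r ler_norml => /andP[].
Qed.

Lemma left_right_cut a : 0 <= a <= alpha -> (left_cut a <= right_cut a)%E.
Proof.
move=> aa; rewrite leNgt; apply/negP => rl.
have : E (lower_test (a + 1 - alpha)) <= E (lower_test a).
  apply: le_wmean => //; [exact: lower_test_bounded..|].
  by move=> y; apply: lower_cut_homo => //; left.
by rewrite !lower_test_mass right_level// left_level//;
    have /andP[al0 al1] := alpha01; lra.
Qed.

Lemma left_cut0 : left_cut 0 = -oo%E.
Proof. by rewrite /left_cut clamp_id// lexx ler01. Qed.

Lemma right_cut_alpha : right_cut alpha = +oo%E.
Proof. by rewrite /right_cut addrC addKr clamp_id// lexx ler01. Qed.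

Lemma two_sided_test_out a y : 0 <= a <= alpha ->
  ((T y)%:E < left_cut a)%E \/ (right_cut a < (T y)%:E)%E ->
  two_sided_test a y = 1.
Proof.
move=> aa; have lr := left_right_cut aa.
rewrite /two_sided_test /lower_test /lower_cut -/(left_cut a) -/(right_cut a).
move=> [Tl|rT].
  by rewrite Tl (lt_le_trans Tl lr); ring.
have lT := le_lt_trans lr rT.
rewrite !ltNge (ltW rT) (ltW lT)/= !gt_eqF//; ring.
Qed.

Lemma two_sided_test_in a y :
  (left_cut a < (T y)%:E)%E -> ((T y)%:E < right_cut a)%E ->
  two_sided_test a y = 0.
Proof.
move=> lT Tr.
rewrite /two_sided_test /lower_test /lower_cut -/(left_cut a) -/(right_cut a).
by rewrite Tr ltNge (ltW lT)/= gt_eqF//; ring.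
Qed.

(** With a common cut [x], the two lower tests that make up the two-sided test
    differ only on [T = x], and their masses differ by [1 - alpha]. The cut is
    finite because tests with infinite cuts carry no randomization. *)
Lemma atom_of_left_eq_right a : 0 <= a <= alpha ->
  left_cut a = right_cut a -> exists x : R, [/\ left_cut a = x%:E &
    1 - alpha <= E (fun y => (T y == x)%:R)].
Proof.
move=> aa lr.
have mass :
    E (fun y => lower_test (a + 1 - alpha) y - lower_test a y) = 1 - alpha.
  rewrite wmeanB//; [|exact: lower_test_bounded..].
  by rewrite !lower_test_mass right_level// left_level//;
    have /andP[al0 al1] := alpha01; lra.
have infinite : (forall y, (T y)%:E != left_cut a) -> False.
  move=> Tl.
  suff : E (fun y => lower_test (a + 1 - alpha) y - lower_test a y) = 0.
    by have /andP[al0 al1] := alpha01; rewrite mass => ?; lra.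
  rewrite -[RHS](wmean_cst iw w1 0); apply: eq_wmean => y.
  rewrite /lower_test /lower_cut -/(left_cut a) -/(right_cut a) -lr.
  by rewrite (negbTE (Tl y)) subrr.
case lE: (left_cut a) lr infinite => [x| |] lr infinite.
- exists x; split => //; rewrite -mass.
  have mTx : measurable_fun setT (fun y => (T y == x)%:R : R).
    rewrite (_ : (fun y => _) = \1_(T @^-1` [set x])).
      by apply: measurable_indic; rewrite -[X in measurable X]setTI; exact: mT.
    by apply/funext => y; rewrite indicE; case: eqP => Tyx;
      [rewrite mem_set|rewrite memNset].
  apply: le_wmean => //.
  + by apply: bounded_measurableB; exact: lower_test_bounded.
  + split => //; exists 1 => y; case: eqP => _; rewrite ?normr1 ?normr0//.
  move=> y.
  rewrite /lower_test /lower_cut -/(left_cut a) -/(right_cut a) lE -lr.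
  rewrite lte_fin eqe; case: ltgtP => //; rewrite ?subrr// => _.
  have /andP[p0 p1] := k01 (clamp 0 1 a).
  by have /andP[q0 q1] := k01 (clamp 0 1 (a + 1 - alpha)); rewrite mulr1n; lra.
- by exfalso; apply: infinite.
- by exfalso; apply: infinite.
Qed.

(** * Comparison at equal size and equal truncated moment *)

(** The tests differ by something nonnegative outside the cuts and nonpositive
    between them. On the cuts nothing is known, hence the demand that [v]
    vanish there. *)
Lemma two_sided_test_sign a (delta : Y -> R) y (v : R) :
  0 <= a <= alpha -> decision_rule delta ->
  (((T y)%:E < left_cut a)%E \/ (right_cut a < (T y)%:E)%E -> 0 <= v) ->
  ((left_cut a < (T y)%:E)%E -> ((T y)%:E < right_cut a)%E -> v <= 0) ->
  ((T y)%:E = left_cut a \/ (T y)%:E = right_cut a -> v = 0) ->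
  0 <= (two_sided_test a y - delta y) * v.
Proof.
move=> aa [_ /(_ y)/andP[d0 d1]] vout vin vcut.
have out : ((T y)%:E < left_cut a \/ right_cut a < (T y)%:E)%E ->
    0 <= (two_sided_test a y - delta y) * v.
  move=> h; rewrite (two_sided_test_out aa h).
  by rewrite mulr_ge0 ?subr_ge0//; exact: vout.
have [Tl|lT|Tl] := ltgtP (T y)%:E (left_cut a).
- by apply: out; left.
- have [Tr|rT|Tr] := ltgtP (T y)%:E (right_cut a).
  + rewrite two_sided_test_in// sub0r mulNr oppr_ge0.
    by rewrite mulr_ge0_le0//; exact: vin.
  + by apply: out; right.
  + by rewrite vcut ?mulr0//; right.
- by rewrite vcut ?mulr0//; left.
Qed.

Let tau m y : R := trunc m (T y)%:E.

Lemma truncated_measurable m : measurable_fun setT (tau m).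
Proof.
apply: (@measurableT_comp _ _ _ _ _ _ (clamp (- m) m)) => //.
by apply: continuous_measurable_fun; exact: clamp_continuous.
Qed.

Lemma truncated_bounded m : 0 <= m -> bounded_measurable (tau m).
Proof.
move=> m0; split; first exact: truncated_measurable.
by exists m => y; rewrite ler_norml; exact: trunc_itv.
Qed.

Lemma wmean_test_diff (b1 b2 h t : Y -> R) (A B : R) :
  bounded_measurable b1 -> bounded_measurable b2 ->
  bounded_measurable h -> bounded_measurable t ->
  E (fun y => (b1 y - b2 y) * (h y - (A * t y + B))) =
  (E (fun y => b1 y * h y) - E (fun y => b2 y * h y))
  - A * (E (fun y => b1 y * t y) - E (fun y => b2 y * t y))
  - B * (E b1 - E b2).
Proof.
move=> m1 m2 mh mt.
have mc (r : R) : bounded_measurable (fun _ : Y => r).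
  exact: bounded_measurable_cst.
have mD h' : bounded_measurable h' ->
    bounded_measurable (fun y => (b1 y - b2 y) * h' y).
  by move=> mh'; apply: bounded_measurableM => //; exact: bounded_measurableB.
rewrite (@eq_wmean _ _ _ _ _ _ (fun y => (b1 y - b2 y) * h y -
  A * ((b1 y - b2 y) * t y) - B * (b1 y - b2 y))); last by move=> y; ring.
have mDB := bounded_measurableB m1 m2.
rewrite wmeanB//;
  [|apply: bounded_measurableB|apply: bounded_measurableM] => //;
  [|exact: mD|apply: bounded_measurableM => //; exact: mD].
rewrite (wmeanB iw)//; [|exact: mD|apply: bounded_measurableM => //; exact: mD].
rewrite !(wmeanZ iw)//; last exact: mD.
rewrite (wmeanB iw m1 m2).
have ED h' : bounded_measurable h' -> E (fun y => (b1 y - b2 y) * h' y) =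
    E (fun y => b1 y * h' y) - E (fun y => b2 y * h' y).
  move=> mh'; rewrite -(wmeanB iw); [|exact: bounded_measurableM..].
  by apply: eq_wmean => y; ring.
by rewrite !ED.
Qed.

(** Among tests of the same size, the upper test ([a = 0]) has the largest
    moment and the lower test ([a = alpha]) the smallest; the moment is
    continuous along the curve. *)
Lemma exists_moment_match (delta : Y -> R) m : 0 <= m -> decision_rule delta ->
  E delta = alpha -> exists2 a, 0 <= a <= alpha &
  E (fun y => two_sided_test a y * tau m y) = E (fun y => delta y * tau m y).
Proof.
move=> m0 rd Ed; have /andP[al0 al1] := alpha01.
have bd := bounded_measurable_rule rd.
have bt := truncated_bounded m0.
have a0 : 0 <= (0 : R) <= alpha by rewrite lexx ltW.
have a1 : 0 <= alpha <= alpha by rewrite lexx ltW.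
pose M a := E (fun y => two_sided_test a y * tau m y).
have M0 : E (fun y => delta y * tau m y) <= M 0.
  have : 0 <= E (fun y => (two_sided_test 0 y - delta y) *
      (tau m y - (0 * tau m y + trunc m (right_cut 0)))).
    apply: Rintegral_ge0 => y _; apply: mulr_ge0 => //.
    apply: two_sided_test_sign => //; rewrite mul0r add0r left_cut0.
    - by move=> [|/ltW rT]; [rewrite ltNge leNye|rewrite subr_ge0 trunc_homo].
    - by move=> _ /ltW Tr; rewrite subr_le0 trunc_homo.
    - by move=> [//|Tr]; rewrite /tau Tr subrr.
  rewrite wmean_test_diff//; last exact: two_sided_test_bounded.
  by rewrite two_sided_test_mass// Ed subrr mulr0 mul0r !subr0 subr_ge0.
have M1 : M alpha <= E (fun y => delta y * tau m y).
  have : 0 <= E (fun y => (two_sided_test alpha y - delta y) *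
      ((fun y => - tau m y) y - (0 * tau m y + - trunc m (left_cut alpha)))).
    apply: Rintegral_ge0 => y _; apply: mulr_ge0 => //.
    apply: two_sided_test_sign => //;
      rewrite mul0r add0r right_cut_alpha opprK addrC.
    - by move=> [/ltW Tl|]; [rewrite subr_ge0 trunc_homo|rewrite ltNge leey].
    - by move=> /ltW lT _; rewrite subr_le0 trunc_homo.
    - by move=> [Tl|//]; rewrite /tau Tl subrr.
  have bNt : bounded_measurable (fun y => - tau m y).
    split; first by apply: measurableT_comp => //; exact: truncated_measurable.
    by have [_ [C tC]] := bt; exists C => y; rewrite normrN.
  rewrite wmean_test_diff//; last exact: two_sided_test_bounded.
  rewrite two_sided_test_mass// Ed subrr mulr0 mul0r !subr0.
  have EN (b : Y -> R) : bounded_measurable b ->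
      E (fun y => b y * - tau m y) = - E (fun y => b y * tau m y).
    move=> mb; rewrite -[RHS]mulN1r -(wmeanZ iw); last first.
      exact: bounded_measurableM.
    by apply: eq_wmean => y; ring.
  rewrite !EN//; last exact: two_sided_test_bounded.
  by rewrite opprK addrC subr_ge0.
have cM : {within `[0, alpha], continuous M}.
  apply: continuous_subspaceT => a; apply/cvgrPdist_lt => e e0.
  pose r := e / (2 * m + 1).
  have m21 : 0 < 2 * m + 1 by lra.
  have r0 : 0 < r by rewrite divr_gt0.
  near=> b.
  have abr : `|a - b| < r by near: b; exact: cvgr_dist_lt.
  have tm y : `|tau m y| <= m by rewrite ler_norml; exact: trunc_itv.
  rewrite (le_lt_trans (two_sided_test_dist a b (truncated_measurable m) tm))//.
  rewrite (@le_lt_trans _ _ ((2 * m + 1) * `|a - b|))// ?ler_wpM2r//; first lra.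
  by rewrite mulrC -ltr_pdivlMr.
have [| a aa Ma] := IVT (ltW al0) cM (v := E (fun y => delta y * tau m y)).
  by rewrite ge_min M1 orbT le_max M0.
by exists a => //; move: aa; rewrite in_itv.
Unshelve. all: by end_near. Qed.

(** The integrand [(delta_a - delta) (phi(T) - line(T))] is nonnegative, for
    the line through the truncated cuts, and the line contributes nothing to
    the integral. *)
Lemma two_sided_test_dominates (delta : Y -> R) a m phi :
  0 <= m -> 0 <= a <= alpha -> decision_rule delta -> E delta = alpha ->
  E (fun y => two_sided_test a y * tau m y) = E (fun y => delta y * tau m y) ->
  below_chords phi -> bounded_measurable (fun y => phi (tau m y)) ->
  E (fun y => delta y * phi (tau m y)) <=
  E (fun y => two_sided_test a y * phi (tau m y)).
Proof.
move=> m0 aa rd Ed Et phic bphi.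
have lr := trunc_homo m0 (left_right_cut aa).
have [A [B AB]] := below_chords_line phic lr.
have : 0 <= E (fun y => (two_sided_test a y - delta y) *
    (phi (tau m y) - (A * tau m y + B))).
  apply: Rintegral_ge0 => y _; apply: mulr_ge0 => //.
  have [pos neg] := AB (tau m y).
  (* Truncation is monotone, so [tau m y] lies on the same side of the
     truncated cuts as [T y] of the cuts. *)
  apply: two_sided_test_sign => //.
  - by move=> [/ltW Tl|/ltW rT]; apply: pos; [left|right]; exact: trunc_homo.
  - by move=> /ltW lT /ltW Tr; apply: neg; rewrite !trunc_homo.
  - move=> Tcut; apply/eqP; rewrite eq_le; apply/andP; split.
      by apply: neg; case: Tcut => Te; rewrite /tau Te lexx ?lr.
    by apply: pos; case: Tcut => Te; rewrite /tau Te lexx; [left|right].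
rewrite (@wmean_test_diff _ _ (fun y => phi (tau m y)))//.
- by rewrite two_sided_test_mass// Ed Et !subrr !mulr0 !subr0 subr_ge0.
- exact: two_sided_test_bounded.
- exact: bounded_measurable_rule.
- exact: truncated_bounded.
Qed.

(** * Power under a density convex in the statistic *)

Section convex_density.
Variable phi : R -> R.
Hypothesis phi_convex : below_chords phi.
Hypothesis phi_ge0 : forall t, 0 <= phi t.
Let v y := phi (T y) * w y.
Hypothesis iv : mu.-integrable setT (EFin \o v).

Definition truncation_error (n : nat) : R :=
  \int[mu]_y (`|phi (T y) - phi (tau n%:R y)| * w y).

Let mphi : measurable_fun setT phi := below_chords_measurable phi_convex.

Let mphiT : measurable_fun setT (fun y => phi (T y)).
Proof. exact: measurableT_comp. Qed.

Let mw : measurable_fun setT w.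
Proof. by apply/measurable_EFinP; exact: (measurable_int mu iw). Qed.

Lemma convex_truncated_measurable m :
  measurable_fun setT (fun y => phi (tau m y)).
Proof. apply: measurableT_comp => //; exact: truncated_measurable. Qed.

Lemma convex_truncated_norm m y : 0 <= m ->
  `|phi (tau m y)| <= Num.max (phi (- m)) (phi m).
Proof.
move=> m0; rewrite ger0_norm//; apply: below_chords_le_max => //.
exact: trunc_itv.
Qed.

Lemma convex_truncated_bounded m : 0 <= m ->
  bounded_measurable (fun y => phi (tau m y)).
Proof.
move=> m0; split; first exact: convex_truncated_measurable.
by exists (Num.max (phi (- m)) (phi m)) => y; exact: convex_truncated_norm.
Qed.

(** The truncated value lies between 0 and [T y]. *)
Lemma convex_truncated_le m y : 0 <= m ->
  phi (tau m y) <= phi 0 + phi (T y).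
Proof.
move=> m0; have mm : - m <= m by lra.
have z0 : clamp (- m) m 0 = 0 by apply: clamp_id; apply/andP; split; lra.
have le_max : Num.max (phi 0) (phi (T y)) <= phi 0 + phi (T y).
  by rewrite ge_max lerDl lerDr !phi_ge0.
apply: le_trans le_max; rewrite /tau /=.
have [T0|/ltW T0] := leP 0 (T y).
  apply: below_chords_le_max => //; have := clamp_homo (- m) m T0.
  rewrite z0 => -> /=; rewrite /clamp ge_max ge_min lexx orbT andbT.
  by lra.
rewrite maxC; apply: below_chords_le_max => //; have := clamp_homo (- m) m T0.
rewrite z0 => ->; rewrite andbT /clamp le_max le_min lexx andbT.
apply/orP; right.
by lra.
Qed.

Let integrable_dominating :
  mu.-integrable setT (EFin \o (fun y => phi 0 * w y + 2 * v y)).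
Proof.
rewrite (_ : _ \o _ = (fun y => (phi 0)%:E * (EFin \o w) y)%E \+
  (fun y => 2%:E * (EFin \o v) y)%E)//.
apply: integrableD => //; exact: integrableZl.
Qed.

Let truncation_error_bound n y :
  `|phi (T y) - phi (tau n%:R y)| * w y <= phi 0 * w y + 2 * v y.
Proof.
rewrite /v mulrA -mulrDl ler_wpM2r// (le_trans (ler_normB _ _))//.
rewrite !ger0_norm//; have := @convex_truncated_le n%:R y (ler0n _ n).
by lra.
Qed.

Let truncation_error_measurable n :
  measurable_fun setT (fun y => `|phi (T y) - phi (tau n%:R y)| * w y).
Proof.
apply: measurable_funM => //; apply: measurableT_comp => //.
by apply: measurable_funB => //; exact: convex_truncated_measurable.
Qed.

(** The integrand vanishes as soon as [n >= |T y|]. *)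
Lemma truncation_error_cvg0 : truncation_error n @[n --> \oo] --> 0.
Proof.
rewrite [X in _ --> X](_ : (0 : R) = \int[mu]_y 0); last first.
  by rewrite /Rintegral integral0.
apply: (Rintegral_dominated_cvg _ _ _ integrable_dominating).
- exact: truncation_error_measurable.
- exact: measurable_cst.
- move=> y; apply: cvg_near_cst; near=> n.
  have Tn : `|T y| <= n%:R.
    by apply: ltW; near: n; exact: nbhs_infty_gtr.
  by rewrite /tau /= clamp_id -?ler_norml// subrr normr0 mul0r.
- move=> n y; rewrite ger0_norm ?truncation_error_bound//.
  by rewrite mulr_ge0.
Unshelve. all: by end_near. Qed.

Lemma wmean_truncation (b : Y -> R) n :
  measurable_fun setT b -> (forall y, `|b y| <= 1) ->
  `|wmean mu v b - E (fun y => b y * phi (tau n%:R y))| <= truncation_error n.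
Proof.
move=> mb b1; have bb : bounded_measurable b by split => //; exists 1.
have n0 : 0 <= n%:R :> R by [].
have i1 := integrable_wmean iv bb.
have i2 := integrable_wmean iw
  (bounded_measurableM bb (convex_truncated_bounded n0)).
rewrite /wmean -RintegralB//.
have i3 : mu.-integrable setT (EFin \o (fun y => b y * v y -
    b y * phi (tau n%:R y) * w y)).
  exact: (integrableB measurableT i1 i2).
apply: (le_trans (le_normr_Rintegral measurableT i3)).
apply: le_Rintegral => //.
- exact: (integrable_norm i3).
- apply: (le_integrable measurableT _ _ integrable_dominating).
    exact/measurable_EFinP.
  move=> y _; rewrite /= lee_fin.
  have h0 : 0 <= `|phi (T y) - phi (tau n%:R y)| * w y by rewrite mulr_ge0.
  have h1 := truncation_error_bound n y.
  by rewrite (ger0_norm h0) (ger0_norm (le_trans h0 h1)).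
- move=> y _; rewrite /v mulrA -mulrBl -mulrBr !normrM -mulrA.
  by rewrite (ger0_norm (w_ge0 y)) ler_piMl// mulr_ge0.
Qed.

Let rule_norm (b : Y -> R) : decision_rule b -> forall y, `|b y| <= 1.
Proof. by move=> [_ h] y; have /andP[h0 h1] := h y; rewrite ger0_norm. Qed.

(** Up to twice the truncation error, the power is an integral with a bounded
    factor, which is Lipschitz in [a] by [two_sided_test_dist]. *)
Lemma wmean_two_sided_test_continuous :
  continuous (fun a => wmean mu v (two_sided_test a)).
Proof.
move=> a; apply/cvgrPdist_lt => e e0.
have e4 : 0 < e / 4 by lra.
have [n errn] : exists n, truncation_error n < e / 4.
  near \oo => n; exists n; near: n.
  exact: (cvgr_lt _ truncation_error_cvg0).
have n0 : 0 <= n%:R :> R by [].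
pose C := Num.max (phi (- n%:R)) (phi n%:R).
have C0 : 0 <= C by rewrite le_max phi_ge0.
pose r := e / (4 * C + 1).
have C41 : 0 < 4 * C + 1 by lra.
have r0 : 0 < r by rewrite divr_gt0.
near=> b.
have abr : `|a - b| < r by near: b; exact: cvgr_dist_lt.
have abe : (4 * C + 1) * `|a - b| < e by rewrite mulrC -ltr_pdivlMr.
have rt a' := two_sided_test_rule a'.
have := wmean_truncation n (rt a).1 (rule_norm (rt a)).
have := wmean_truncation n (rt b).1 (rule_norm (rt b)).
have := two_sided_test_dist a b (convex_truncated_measurable n%:R)
  (fun y => convex_truncated_norm y n0).
rewrite -/C.
have ab0 : 0 <= `|a - b| by [].
rewrite !ler_norml => /andP[h1 h2] /andP[h3 h4] /andP[h5 h6].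
rewrite ltr_norml; apply/andP; split; lra.
Unshelve. all: by end_near. Qed.

Lemma two_sided_test_almost_dominates (delta : Y -> R) a n :
  0 <= a <= alpha -> decision_rule delta -> E delta = alpha ->
  E (fun y => two_sided_test a y * tau n%:R y) =
    E (fun y => delta y * tau n%:R y) ->
  wmean mu v delta - 2 * truncation_error n <= wmean mu v (two_sided_test a).
Proof.
move=> aa rd Ed Et; have n0 : 0 <= n%:R :> R by [].
have rt := two_sided_test_rule a.
have := two_sided_test_dominates n0 aa rd Ed Et phi_convex
  (convex_truncated_bounded n0).
have := wmean_truncation n rt.1 (rule_norm rt).
have := wmean_truncation n rd.1 (rule_norm rd).
by rewrite !ler_norml => /andP[h1 h2] /andP[h3 h4] h5; lra.
Qed.

End convex_density.

(** * The best two-sided test is optimal among all tests *)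

Section optimization.
Context d' (Theta : measurableType d').
Variables (Lambda : probability Theta R).
Variables (F : Theta -> Y -> R) (phi : Theta -> R -> R).
Hypothesis F_phi : forall theta, F theta = (fun y => phi theta (T y) * w y).
Hypothesis phi_convex : forall theta, below_chords (phi theta).
Hypothesis phi_ge0 : forall theta t, 0 <= phi theta t.
Hypothesis iF : forall theta, mu.-integrable setT (EFin \o F theta).
Hypothesis power_measurable : forall delta, decision_rule delta ->
  measurable_fun setT (fun theta => wmean mu (F theta) delta).
Variables (G : R -> R) (bound : R).
Hypothesis G_continuous : continuous G.
Hypothesis G_homo : {homo G : s t / s <= t}.
Hypothesis G_bounded : forall t, `|G t| <= bound.

Let payoff delta : R := \int[Lambda]_theta G (wmean mu (F theta) delta).

Let F_ge0 theta y : 0 <= F theta y.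
Proof. by rewrite F_phi mulr_ge0. Qed.

Let G_measurable (p : Theta -> R) : measurable_fun setT p ->
  measurable_fun setT (fun theta => G (p theta)).
Proof.
by move=> mp; apply: measurableT_comp => //; exact: continuous_measurable_fun.
Qed.

Let bound_integrable : Lambda.-integrable setT (EFin \o (fun _ => bound)).
Proof. exact: finite_measure_integrable_cst. Qed.

Let G_integrable (p : Theta -> R) : measurable_fun setT p ->
  Lambda.-integrable setT (EFin \o (fun theta => G (p theta))).
Proof.
move=> mp; apply: (le_integrable measurableT _ _ bound_integrable).
  by apply/measurable_EFinP; exact: G_measurable.
move=> theta _; rewrite /= lee_fin (le_trans (G_bounded _))// ler_norm//.
Qed.

Let G_cvg (p_ : nat -> Theta -> R) (p : Theta -> R) :
  (forall n, measurable_fun setT (p_ n)) -> measurable_fun setT p ->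
  (forall theta, p_ n theta @[n --> \oo] --> p theta) ->
  \int[Lambda]_theta G (p_ n theta) @[n --> \oo] -->
  \int[Lambda]_theta G (p theta).
Proof.
move=> mp_ mp pp; apply: (Rintegral_dominated_cvg _ _ _ bound_integrable).
- by move=> n; exact: G_measurable.
- exact: G_measurable.
- by move=> theta; apply: continuous_cvg; [exact: G_continuous|exact: pp].
- by move=> n theta; exact: G_bounded.
Qed.

Let le_payoff (p p' : Theta -> R) :
  measurable_fun setT p -> measurable_fun setT p' ->
  (forall theta, p theta <= p' theta) ->
  \int[Lambda]_theta G (p theta) <= \int[Lambda]_theta G (p' theta).
Proof.
move=> mp mp' pp'; apply: le_Rintegral => //; [exact: G_integrable..|].
by move=> theta _; exact: G_homo.
Qed.

Lemma exists_best_two_sided_test : exists2 a, 0 <= a <= alpha &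
  forall b, 0 <= b <= alpha ->
    payoff (two_sided_test b) <= payoff (two_sided_test a).
Proof.
have /andP[al0 al1] := alpha01.
have cJ : continuous (fun a => payoff (two_sided_test a)).
  move=> a; apply/(@cvg_nbhsP _ R^o) => u ua; apply: G_cvg.
  - by move=> n; exact/power_measurable/two_sided_test_rule.
  - exact/power_measurable/two_sided_test_rule.
  - move=> theta; rewrite F_phi.
    have iv : mu.-integrable setT (EFin \o (fun y => phi theta (T y) * w y)).
      by rewrite -F_phi.
    have := wmean_two_sided_test_continuous (phi_convex theta)
      (phi_ge0 theta) iv (x := a).
    by move/(@cvg_nbhsP _ R^o); apply.
have [a aa amax] := EVT_max (ltW al0) (continuous_subspaceT cJ).
by exists a => [|b ab]; [move: aa|apply: amax]; rewrite in_itv.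
Qed.

(** Reject in addition with a fixed probability wherever [delta] accepts. *)
Lemma exists_larger_rule (delta : Y -> R) :
  decision_rule delta -> E delta <= alpha ->
  exists delta', [/\ decision_rule delta', E delta' = alpha &
    forall y, delta y <= delta' y].
Proof.
move=> rd Ed; have /andP[al0 al1] := alpha01.
have bd := bounded_measurable_rule rd.
have Ed1 : 0 < 1 - E delta by lra.
pose r := (alpha - E delta) / (1 - E delta).
have r0 : 0 <= r by rewrite divr_ge0 ?subr_ge0// ltW// -subr_gt0.
have r1 : r <= 1 by rewrite ler_pdivrMr// mul1r; lra.
have b1 : bounded_measurable (fun y => 1 - delta y).
  by apply: bounded_measurableB => //; exact: bounded_measurable_cst.
exists (fun y => delta y + r * (1 - delta y)); split.
- split; first apply: measurable_funD => //.
  + exact: rd.1.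
  + by apply: measurable_funM => //; exact: b1.1.
  + move=> y; have /andP[h0 h1] := rd.2 y.
    by apply/andP; split; nra.
- rewrite (wmeanD iw)//; last first.
    by apply: bounded_measurableM => //; exact: bounded_measurable_cst.
  rewrite (wmeanZ iw)// (wmeanB iw)//; last exact: bounded_measurable_cst.
  rewrite (wmean_cst iw w1) /r; field.
  by rewrite gt_eqF.
- by move=> y; have /andP[h0 h1] := rd.2 y; rewrite lerDl mulr_ge0// subr_ge0.
Qed.

(** The tests [two_sided_test (b n)] match the moment of [delta] truncated at
    [n] and so dominate [delta] up to the truncation error. That error is not
    known to be uniform, nor measurable, in [theta]; taking minima of powers
    keeps both measurability and the pointwise limit. *)
Lemma exists_optimal_two_sided_test : exists2 a, 0 <= a <= alpha &
  forall delta, decision_rule delta -> E delta <= alpha ->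
    payoff delta <= payoff (two_sided_test a).
Proof.
have [a aa amax] := exists_best_two_sided_test.
exists a => // delta0 rd0 Ed0.
have [delta [rd Ed d0d]] := exists_larger_rule rd0 Ed0.
apply: (@le_trans _ _ (payoff delta)).
  apply: le_payoff; [exact: power_measurable..|] => theta.
  by apply: le_wmean => //; exact: bounded_measurable_rule.
have /choice[b bP] : forall n : nat, exists b, 0 <= b <= alpha /\
    E (fun y => two_sided_test b y * tau n%:R y) =
    E (fun y => delta y * tau n%:R y).
  by move=> n; have [b ? ?] := exists_moment_match (ler0n _ n) rd Ed; exists b.
pose p theta := wmean mu (F theta) delta.
pose q n theta := wmean mu (F theta) (two_sided_test (b n)).
have mp : measurable_fun setT p by exact: power_measurable.
have mq n : measurable_fun setT (q n).
  exact/power_measurable/two_sided_test_rule.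
have mmin n : measurable_fun setT (fun theta => Num.min (q n theta) (p theta)).
  exact: measurable_minr.
have cvg_min theta : Num.min (q n theta) (p theta) @[n --> \oo] --> p theta.
  have iv : mu.-integrable setT (EFin \o (fun y => phi theta (T y) * w y)).
    by rewrite -F_phi.
  have err0 := truncation_error_cvg0 (phi_convex theta) (phi_ge0 theta) iv.
  have sandwich n : p theta - 2 * truncation_error (phi theta) n <=
      Num.min (q n theta) (p theta) <= p theta.
    apply/andP; split; last by rewrite ge_min lexx orbT.
    have er_ge0 : 0 <= truncation_error (phi theta) n.
      by apply: Rintegral_ge0 => y _; rewrite mulr_ge0.
    rewrite le_min gerBl mulr_ge0// andbT /p /q F_phi.
    have [bn Ebn] := bP n.
    exact: (two_sided_test_almost_dominates (phi_convex theta)).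
  have lower_cvg : p theta - 2 * truncation_error (phi theta) n @[n --> \oo]
      --> p theta.
    rewrite -[X in _ --> X]subr0; apply: cvgB; first exact: cvg_cst.
    by rewrite -[X in _ --> X](mulr0 2); apply: cvgMl_tmp.
  by apply: (squeeze_cvgr _ lower_cvg (cvg_cst (p theta))); exact: nearW.
apply: (cvgr_to_le (G_cvg mmin mp cvg_min)); near=> n.
apply: le_trans (amax _ (bP n).1).
apply: (le_payoff (mmin n) (mq n)) => theta.
by rewrite ge_min lexx.
Unshelve. all: by end_near. Qed.

End optimization.

End two_sided.

(** * Existence of an optimum for a utility defined on [[0, 1]] *)

Section clamped_utility.
Context {R : realType}.
Variable g : R -> R.

(** Powers lie in [[0, 1]], where the clamp is the identity. So [g] may be
    replaced by a function that is continuous, nondecreasing and bounded on the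
    whole line. *)
Lemma clamp_comp_continuous : {within `[0, 1], continuous g} ->
  continuous (fun t => g (clamp 0 1 t)).
Proof.
move=> /subspace_continuousP cg x.
have c01 t : `[0, 1]%classic (clamp 0 1 t : R).
  by rewrite /= in_itv/=; exact: clamp_itv.
apply: (@cvg_comp _ _ _ (clamp 0 1) g _ _ _ _ (cg _ (c01 x))).
move=> U; rewrite /within/= => nU.
have near_x : \forall t \near x, `[0, 1]%classic (clamp 0 1 t : R) ->
    U (clamp 0 1 t) by exact: (@clamp_continuous R 0 1 x _ nU).
by apply: (filterS _ near_x) => t; apply; exact: c01.
Qed.

Lemma clamp_comp_homo : derivable_oo_LRcontinuous g 0 1 ->
  (forall t, 0 < t < 1 -> 0 < (g^`())%classic t) ->
  {homo (fun t => g (clamp 0 1 t)) : s t / s <= t}.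
Proof.
move=> dg g'0 s t st.
apply: (@ger0_derive1_le_cc _ g 0 1);
  rewrite ?in_itv/= ?clamp_itv ?clamp_homo//.
- by case: dg.
- by move=> x; rewrite in_itv/= => /g'0 /ltW.
- exact: derivable_oo_LRcontinuous_within.
Qed.

End clamped_utility.

(** The randomization at the cuts is the one of [delta] itself. *)
Lemma exists_two_sided_optimum d (Y : measurableType d) d'
    (Theta : measurableType d') (R : realType) (mu : {measure set Y -> \bar R})
    (Lambda : probability Theta R) (w T : Y -> R) (F : Theta -> Y -> R)
    (phi : Theta -> R -> R) (G : R -> R) (alpha bound : R) :
  mu.-integrable setT (EFin \o w) -> (forall y, 0 <= w y) ->
  \int[mu]_y w y = 1 -> measurable_fun setT T -> 0 < alpha < 1 ->
  (forall theta, F theta = (fun y => phi theta (T y) * w y)) ->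
  (forall theta, below_chords (phi theta)) ->
  (forall theta t, 0 <= phi theta t) ->
  (forall theta, mu.-integrable setT (EFin \o F theta)) ->
  (forall delta, decision_rule delta ->
    measurable_fun setT (fun theta => wmean mu (F theta) delta)) ->
  continuous G -> {homo G : s t / s <= t} -> (forall t, `|G t| <= bound) ->
  exists (delta : Y -> R) (l u : \bar R),
    [/\ decision_rule delta, wmean mu w delta = alpha,
      forall delta', decision_rule delta' -> wmean mu w delta' <= alpha ->
        \int[Lambda]_theta G (wmean mu (F theta) delta') <=
        \int[Lambda]_theta G (wmean mu (F theta) delta),
      (l < u)%E \/ exists x : R, [/\ l = x%:E, u = x%:E &
        1 - alpha <= wmean mu w (fun y => (T y == x)%:R)] &
      forall y, delta y =
        if (u < (T y)%:E)%E || ((T y)%:E < l)%E then 1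
        else if ((T y)%:E == l) || ((T y)%:E == u) then delta y else 0].
Proof.
move=> iw w_ge0 w1 mT alpha01 F_phi phi_convex phi_ge0 iF power_meas cG hG bG.
have [c [k [k01 mass_c c0 c1]]] := exists_lower_cut_family iw w_ge0 w1 mT.
have [a aa aopt] := exists_optimal_two_sided_test iw w_ge0 w1 mT k01 mass_c
  c0 c1 alpha01 Lambda F_phi phi_convex phi_ge0 iF power_meas cG hG bG.
exists (two_sided_test T c k alpha a), (left_cut c a), (right_cut c alpha a).
have lr := left_right_cut iw w_ge0 mT k01 mass_c alpha01 aa.
split.
- exact: (two_sided_test_rule iw w_ge0 mT k01 mass_c alpha01).
- exact: (two_sided_test_mass iw w1 mT k01 mass_c alpha01).
- exact: aopt.
- move: lr; rewrite le_eqVlt => /orP[/eqP lr|]; last by left.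
  have [x [lx atom]] :=
    atom_of_left_eq_right iw w_ge0 w1 mT k01 mass_c alpha01 aa lr.
  by right; exists x; split => //; rewrite -lr.
- move=> y; case: ifPn => [Tout|].
    apply: (two_sided_test_out iw w_ge0 mT k01 mass_c alpha01 aa).
    by move/orP: Tout => [uT|Tl]; [right|left].
  rewrite negb_or -!leNgt => /andP[Tu lT]; case: ifPn => //.
  rewrite negb_or => /andP[Tl Tu'].
  by rewrite two_sided_test_in// lt_neqAle ?Tu' ?Tu// eq_sym Tl.
Qed.

(** * Borel subsets of Euclidean space and measurability of the power *)

Section borel.
Context {R : realType}.

(** Measurability of a function on a subset of a product can only be transported
    when that subset is measurable; here compactness makes it closed. *)
Lemma compact_borel_measurable n (A : set 'rV[R]_n) : compact A ->
  measurable (A : set (borel_rV R n)).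
Proof.
move=> /(compact_closed (@norm_hausdorff _ _)) cA.
rewrite -[A]setCK; apply: measurableC; apply: sub_sigma_algebra.
exact: closed_openC.
Qed.

Lemma inclusion_measurable n (A : set 'rV[R]_n) (A0 : A !=set0) :
  measurable_fun setT (fun x : borel_subset A0 => proj1_sig x : borel_rV R n).
Proof.
by move=> _ B mB; rewrite setTI; exists B => //; rewrite setTI.
Qed.

Variables (n1 n2 : nat) (Theta : set 'rV[R]_n1) (A : set 'rV[R]_n1).
Variables (A0 : A !=set0) (B : set 'rV[R]_n2) (B0 : B !=set0).
Variable f : 'rV[R]_n1 -> borel_subset B0 -> R.
Hypothesis Theta_compact : compact Theta.
Hypothesis A_Theta : A `<=` Theta.
Hypothesis f_meas : measurable_fun
  (Theta `*` setT : set (borel_rV R n1 * borel_subset B0))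
  (fun z => f z.1 z.2).

Let mThetaT : measurable
  (Theta `*` setT : set (borel_rV R n1 * borel_subset B0)).
Proof. by apply: measurableX => //; exact: compact_borel_measurable. Qed.

Lemma density_measurable theta : Theta theta -> measurable_fun setT (f theta).
Proof.
move=> Ttheta.
apply: (measurable_comp (g := fun y => (theta : borel_rV R n1, y))
  mThetaT _ f_meas).
  by move=> _ [y _ <-].
exact: measurable_pair1.
Qed.

Lemma density_jointly_measurable : measurable_fun setT
  (fun z : borel_subset A0 * borel_subset B0 => f (proj1_sig z.1) z.2).
Proof.
apply: (measurable_comp (g := fun z : borel_subset A0 * borel_subset B0 =>
  (proj1_sig z.1 : borel_rV R n1, z.2)) mThetaT _ f_meas).
  by move=> _ [[x y] _ <-]; split => //=; apply: A_Theta; exact: (proj2_sig x).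
apply/measurable_fun_pair => //.
by apply: (measurableT_comp (@inclusion_measurable _ _ A0)).
Qed.

Hypothesis f_ge0 : forall theta y, Theta theta -> 0 <= f theta y.

(** Tonelli, with the alternatives as first factor. *)
Lemma power_measurable
    (mu : {sigma_finite_measure set (borel_subset B0) -> \bar R})
    (delta : borel_subset B0 -> R) : decision_rule delta ->
  measurable_fun setT
    (fun theta : borel_subset A0 => power mu f (proj1_sig theta) delta).
Proof.
move=> rd.
pose h (z : borel_subset A0 * borel_subset B0) :=
  (delta z.2 * f (proj1_sig z.1) z.2)%:E.
have mh : measurable_fun setT h.
  apply/measurable_EFinP; apply: measurable_funM.
    exact: (measurableT_comp rd.1).
  exact: density_jointly_measurable.
have h0 z : (0 <= h z)%E.
  rewrite lee_fin mulr_ge0//; first by case/andP: (rd.2 z.2).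
  by apply: f_ge0; apply: A_Theta; exact: (proj2_sig z.1).
have := measurable_fun_fubini_tonelli_F (m2 := mu) h mh h0.
exact: (measurableT_comp (fine_measurable measurableT)).
Qed.

End borel.

Lemma eq_wmean_off_null d (Y : measurableType d) (R : realType)
    (mu : {measure set Y -> \bar R}) (w b b' : Y -> R) (N : set Y) :
  measurable_fun setT w -> measurable_fun setT b -> measurable_fun setT b' ->
  measurable N -> mu N = 0%E -> (forall y, ~ N y -> b y = b' y) ->
  wmean mu w b = wmean mu w b'.
Proof.
move=> mw mb mb' mN N0 bb'; congr fine; apply: ae_eq_integral => //.
- by apply/measurable_EFinP; exact: measurable_funM.
- by apply/measurable_EFinP; exact: measurable_funM.
- exists N; split => // y /= neq; apply: contrapT => Ny; apply: neq => _.
  by rewrite bb'.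
Qed.

Lemma wmean_preimage1 d (Y : measurableType d) (R : realType)
    (mu : {measure set Y -> \bar R}) (w T : Y -> R) (x : R) :
  mu.-integrable setT (EFin \o w) -> measurable_fun setT T ->
  (wmean mu w (fun y => (T y == x)%:R))%:E =
  (\int[mu]_(y in T @^-1` [set x]) (w y)%:E)%E.
Proof.
move=> iw mT.
have mTx : measurable (T @^-1` [set x]).
  by rewrite -[X in measurable X]setTI; exact: mT.
have -> : wmean mu w (fun y => (T y == x)%:R) =
    \int[mu]_(y in T @^-1` [set x]) w y.
  rewrite Rintegral_mkcond; apply: eq_Rintegral => y _.
  rewrite patchE; case: eqP => Tyx; first by rewrite mem_set// mul1r.
  by rewrite memNset// mul0r.
rewrite fineK//; apply: integrable_fin_num => //.
exact: (integrableS measurableT mTx _ iw).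
Qed.

Unset Implicit Arguments.
Set Strict Implicit.

Theorem corollary6 (R : realType) (d1 d2 : nat) (d1_gt0 : (0 < d1)%N)
  (d2_gt0 : (0 < d2)%N)
  (Theta : set 'rV[R]_d1) (Theta_compact : compact Theta)
  (theta0 : 'rV[R]_d1) (Theta_theta0 : Theta theta0)
  (Theta1_neq0 : Theta `\ theta0 !=set0)
  (YY : set 'rV[R]_d2) (YY_neq0 : YY !=set0)
  (mu : {sigma_finite_measure set (borel_subset YY_neq0) -> \bar R})
  (f : 'rV[R]_d1 -> borel_subset YY_neq0 -> R)
  (f_meas : measurable_fun
     (Theta `*` setT : set (borel_rV R d1 * borel_subset YY_neq0))
     (fun z => f z.1 z.2))
  (f_ge0 : forall theta y, Theta theta -> 0 <= f theta y)
  (f_pdf : forall theta, Theta theta ->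
     (\int[mu]_y (f theta y)%:E = 1)%E)
  (alpha : R) (alpha01 : 0 < alpha < 1)
  (g : R -> R) (g_meas : measurable_fun (`[0, 1] : set R) g)
  (Lambda1 : probability (borel_subset Theta1_neq0) R)
  (* (A1) *)
  (f_L1_continuous : forall (theta_ : nat -> 'rV[R]_d1) (theta : 'rV[R]_d1),
     (forall n, Theta (theta_ n)) -> Theta theta ->
     theta_ n @[n --> \oo] --> theta ->
     (\int[mu]_y `|f (theta_ n) y - f theta y|%:E)%E @[n --> \oo] --> 0%E)
  (mutually_ac : forall theta theta', Theta theta -> Theta theta' ->
     density_measure mu f theta `<< density_measure mu f theta')
  (* (A2): [derivable_oo_LRcontinuous] is differentiability on the open
     interval and one-sided continuity at its end points *)
  (g_derivable : derivable_oo_LRcontinuous g 0 1)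
  (g'_continuous : forall t : R, 0 < t < 1 -> {for t, continuous (g^`())%classic})
  (* (A3) *)
  (g'_gt0 : forall t : R, 0 < t < 1 -> 0 < (g^`())%classic t)
  (T : borel_subset YY_neq0 -> R) (T_meas : measurable_fun setT T)
  (f_ratio : forall theta, (Theta `\ theta0) theta ->
     exists phi : R -> R, strictly_convex phi /\
       forall y, f theta y = phi (T y) * f theta0 y) :
  (exists (delta : borel_subset YY_neq0 -> R) (l u : \bar R)
          (gamma : borel_subset YY_neq0 -> R),
     [/\ optimal_rule (fun theta : borel_subset Theta1_neq0 => proj1_sig theta)
           mu f g Lambda1 theta0 alpha delta,
         power mu f theta0 delta = alpha,
         (* l = u cannot be excluded when T has an atom of mass at least
            1 - alpha: the rule may reject off {T = c} and randomize on it *)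
         (l < u)%E \/
         (exists c : R, [/\ l = c%:E, u = c%:E &
            ((1 - alpha)%:E <=
             density_measure mu f theta0 (T @^-1` [set c]))%E]),
         decision_rule gamma &
         forall y, delta y =
           if (u < (T y)%:E)%E || ((T y)%:E < l)%E then 1
           else if ((T y)%:E == l) || ((T y)%:E == u) then gamma y
           else 0]) /\
  ((forall c : R, mu (T @^-1` [set c]) = 0%E) ->
   exists (delta : borel_subset YY_neq0 -> R) (l u : \bar R),
     [/\ optimal_rule (fun theta : borel_subset Theta1_neq0 => proj1_sig theta)
           mu f g Lambda1 theta0 alpha delta,
         power mu f theta0 delta = alpha,
         (l < u)%E &
         forall y, delta y =
           ((u <= (T y)%:E)%E || ((T y)%:E <= l)%E)%:R]).
Proof.
have Th1 : Theta `\ theta0 `<=` Theta by move=> theta [].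
pose F (theta : borel_subset Theta1_neq0) := f (proj1_sig theta).
have sub1 (theta : borel_subset Theta1_neq0) : Theta (proj1_sig theta).
  exact: (proj2_sig theta).1.
have mf theta : Theta theta -> measurable_fun setT (f theta).
  exact: (density_measurable Theta_compact f_meas).
have fi theta : Theta theta -> mu.-integrable setT (EFin \o f theta).
  move=> Ttheta; apply/integrableP; split; first exact/measurable_EFinP/mf.
  under eq_integral do rewrite /= ger0_norm ?f_ge0//.
  by rewrite f_pdf// ltry.
have f1 theta : Theta theta -> \int[mu]_y f theta y = 1.
  by move=> Ttheta; rewrite /Rintegral f_pdf.
have /choice[phi phiP] : forall theta : borel_subset Theta1_neq0,
    exists phi : R -> R, [/\ below_chords phi, forall t, 0 <= phi t &
      F theta = (fun y => phi (T y) * f theta0 y)].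
  move=> theta; have [phi [phic fphi]] := f_ratio _ (proj2_sig theta).
  (* [phi] may be negative where no mass of the null density lies, hence the
     positive part. *)
  exists (fun t => Num.max 0 (phi t)); split.
  - exact/below_chords_pos_part/below_chords_strictly_convex.
  - by move=> t; rewrite le_max lexx.
  - apply/funext => y; rewrite /F fphi.
    have := f_ge0 theta0 y Theta_theta0.
    rewrite le_eqVlt => /orP[/eqP <-|f0]; first by rewrite !mulr0.
    have := f_ge0 _ y (sub1 theta); rewrite fphi pmulr_lge0// => phi0.
    by rewrite (max_idPr phi0).
have mpower delta : decision_rule delta -> measurable_fun setT
    (fun theta => wmean mu (F theta) delta).
  exact: (power_measurable Theta_compact Th1 f_meas f_ge0).
pose G t := g (clamp 0 1 t).
have cG : continuous G.
  exact/clamp_comp_continuous/derivable_oo_LRcontinuous_within.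
have hG : {homo G : s t / s <= t} by exact: clamp_comp_homo.
have bG t : `|G t| <= `|g 0| + `|g 1|.
  have G0 : g 0 <= G t.
    rewrite -[X in g X](@clamp_id _ 0 1 0) ?lexx ?ler01//.
    have /andP[t0 _] := clamp_itv t (@ler01 R).
    by rewrite /G -[X in _ <= g X](@clamp_id _ 0 1) ?clamp_itv//; exact: hG.
  have G1 : G t <= g 1.
    rewrite -[X in _ <= g X](@clamp_id _ 0 1 1) ?lexx ?ler01//.
    have /andP[_ t1] := clamp_itv t (@ler01 R).
    by rewrite /G -[X in g X <= _](@clamp_id _ 0 1) ?clamp_itv//; exact: hG.
  have := ler_norm (g 1); have := lerNnormlW (lexx `|g 0|).
  have := normr_ge0 (g 1); have := normr_ge0 (g 0).
  by rewrite ler_norml => ????; apply/andP; split; lra.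
have [delta [l [u [rd Ed opt lu deltaE]]]] := exists_two_sided_optimum Lambda1
  (fi _ Theta_theta0) (fun y => f_ge0 theta0 y Theta_theta0) (f1 _ Theta_theta0)
  T_meas alpha01 (fun theta => let: And3 _ _ h := phiP theta in h)
  (fun theta => let: And3 h _ _ := phiP theta in h)
  (fun theta => let: And3 _ h _ := phiP theta in h)
  (fun theta => fi _ (sub1 theta)) mpower cG hG bG.
have objectiveE delta' : decision_rule delta' ->
    objective (fun theta : borel_subset Theta1_neq0 => proj1_sig theta)
      mu f g Lambda1 delta' =
    \int[Lambda1]_theta G (wmean mu (F theta) delta').
  move=> rd'; apply: eq_Rintegral => theta _; rewrite /G clamp_id//.
  exact: (wmean_rule (fi _ (sub1 theta)) (fun y => f_ge0 _ y (sub1 theta))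
    (f1 _ (sub1 theta))).
have delta_opt : optimal_rule
    (fun theta : borel_subset Theta1_neq0 => proj1_sig theta)
    mu f g Lambda1 theta0 alpha delta.
  split => //; first by rewrite /power -/(wmean _ _ _) Ed.
  by move=> delta' rd' Ed'; rewrite !objectiveE//; exact: opt.
have atom x : (1 - alpha <= wmean mu (f theta0) (fun y => (T y == x)%:R)) ->
    ((1 - alpha)%:E <= density_measure mu f theta0 (T @^-1` [set x]))%E.
  by rewrite -lee_fin (wmean_preimage1 _ (fi _ Theta_theta0) T_meas).
split.
  exists delta, l, u, delta; split => //.
  case: lu => [|[x [lx ux hx]]]; [by left|].
  by right; exists x; split => //; exact: atom.
move=> T_diffuse.
have mTc c : measurable (T @^-1` [set c]).
  by rewrite -[X in measurable X]setTI; exact: T_meas.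
have lt_lu : (l < u)%E.
  case: lu => // -[x [_ _ /atom]].
  rewrite /density_measure null_set_integral.
  - by rewrite lee_fin subr_le0 leNgt; case/andP: alpha01 => _ ->.
  - exact: mTc.
  - have mE : measurable_fun setT (EFin \o f theta0).
      exact/measurable_EFinP/mf.
    exact: (measurable_funTS mE).
  - exact: T_diffuse.
have cut_null (c : \bar R) : measurable [set y | (T y)%:E = c] /\
    mu [set y | (T y)%:E = c] = 0%E.
  case: c => [c| |].
  - rewrite (_ : [set y | _] = T @^-1` [set c])//.
    by apply/seteqP; split => y /=; [case|move=> ->].
  - by rewrite (_ : [set y | _] = set0) ?measure0//; apply/seteqP; split.
  - by rewrite (_ : [set y | _] = set0) ?measure0//; apply/seteqP; split.
have [mNl Nl0] := cut_null l; have [mNu Nu0] := cut_null u.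
pose N := [set y | (T y)%:E = l] `|` [set y | (T y)%:E = u].
have mN : measurable N by exact: measurableU.
have N0 : mu N = 0%E by rewrite null_set_setU.
(* [delta] and [delta'] differ at most on [T = l] and [T = u]. *)
pose delta' y : R := ((u <= (T y)%:E)%E || ((T y)%:E <= l)%E)%:R.
have rd' : decision_rule delta'.
  split; last by move=> y; rewrite /delta'; case: (_ || _); rewrite lexx ler01.
  rewrite (_ : delta' = fun y => if (u <= (T y)%:E)%E || ((T y)%:E <= l)%E
    then 1 else 0); last by apply/funext => y; rewrite /delta'; case: (_ || _).
  apply: measurable_fun_ifT => //; apply: measurable_or.
    by apply: measurable_fun_lee => //; exact/measurable_EFinP.
  by apply: measurable_fun_lee => //; exact/measurable_EFinP.
have delta'E y : ~ N y -> delta y = delta' y.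
  move=> Ny; rewrite deltaE /delta'.
  have Tl : (T y)%:E != l by apply/eqP => h; apply: Ny; left.
  have Tu : (T y)%:E != u by apply/eqP => h; apply: Ny; right.
  rewrite (negbTE Tl) (negbTE Tu)/= !le_eqVlt (negbTE Tl) eq_sym (negbTE Tu)/=.
  by case: (_ || _).
have powerE theta : Theta theta ->
    power mu f theta delta' = power mu f theta delta.
  move=> Ttheta; symmetry.
  exact: (eq_wmean_off_null (mf _ Ttheta) rd.1 rd'.1 mN N0 delta'E).
exists delta', l, u; split => //; last by rewrite powerE.
split => //; first by rewrite powerE// /power -/(wmean _ _ _) Ed.
move=> delta'' rd'' Ed''; have [_ _ /(_ _ rd'' Ed'')] := delta_opt.
suff -> : objective (fun theta : borel_subset Theta1_neq0 => proj1_sig theta)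
    mu f g Lambda1 delta' =
    objective (fun theta : borel_subset Theta1_neq0 => proj1_sig theta)
      mu f g Lambda1 delta.
  by [].
by apply: eq_Rintegral => theta _; rewrite powerE.
Qed.
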